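(* Let $\mathbf{d}$ be a Dyck path on an $n\times n$ board with bounce number $|\mathbf{m}|=3$, let $P=P(\mathbf{d})$, and let $G=\mathrm{inc}(P)$. Let $c=|S_1|$, $b=|S_2|$, $a=|S_3|$. Then for every integer $l$ with $0\le l\le\min\{a,b,c\}$, the coefficient of $e_{(n-2l,l,l)}$ in the expansion of $X_G(\mathbf{x},q)$ in the elementary symmetric function basis lies in $\mathbb{N}[q]$.
   Context: A Dyck path on an $n\times n$ board is a sequence $\mathbf{d}=(d_1,\dots,d_{n-1})$ of positive integers with $d_1\le\cdots\le d_{n-1}\le n$ and $d_i\ge i$. The poset $P(\mathbf{d})$ on $[n]$ has relations $i\prec j$ iff $i<n$ and $d_i<j\le n$ (a natural unit interval order). The bounce sequence $\mathbf{m}=(m_0,\dots,m_l)$ is given by $m_0=d_1$, $m_i=d_{m_{i-1}+1}$, stopping at $m_l=n$; the bounce number is $|\mathbf{m}|=l+1$. When $|\mathbf{m}|=3$, $\mathbf{m}=(m_0,m_1,n)$ and $S_1=\{1,\dots,m_0\}$, $S_2=\{m_0+1,\dots,m_1\}$, $S_3=\{m_1+1,\dots,n\}$. The incomparability graph $\mathrm{inc}(P)$ has vertex set $[n]$ with an edge between two elements iff they are incomparable in $P$. For a graph $G$ on vertex set $[n]$, the chromatic quasisymmetric function is $X_G(\mathbf{x},q)=\sum_{\kappa}q^{\mathrm{asc}(\kappa)}\prod_{v}x_{\kappa(v)}$, summed over proper colorings $\kappa:[n]\to\{1,2,3,\dots\}$, where $\mathrm{asc}(\kappa)$ is the number of edges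 $\{i,j\}$ with $i<j$ and $\kappa(i)<\kappa(j)$; for $G=\mathrm{inc}(P(\mathbf{d}))$ it is symmetric in $\mathbf{x}$, and $e_\lambda$ denotes the elementary symmetric functions. *)

(* Defs.v *)
From HB Require Import structures.
From mathcomp Require Import all_boot all_order all_algebra.
From mathcomp Require Import mpoly.

Set Implicit Arguments.
Unset Strict Implicit.
Unset Printing Implicit Defensive.

Import GRing.Theory Num.Theory.

Local Open Scope nat_scope.

(* [d_at n d i] is d_i with i counted from 1.  The bounce recursion may ask
   for d_n, which is not part of d = (d_1, ..., d_{n-1}); it is read as n, the
   only value allowed by i <= d_i <= n. *)
Definition d_at (n : nat) (d : seq nat) (i : nat) : nat := nth n d i.-1.

Definition dyck_path (n : nat) (d : seq nat) : Prop :=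
  [/\ size d = n.-1,
      forall i, 0 < i < n -> 0 < d_at n d i,
      sorted leq d,
      forall i, 0 < i < n -> d_at n d i <= n
    & forall i, 0 < i < n -> i <= d_at n d i].

(* Since d_{m+1} >= m+1, the sequence increases strictly until it reaches n,
   so [n] units of fuel are enough on a Dyck path. *)
Fixpoint bounce_from (n : nat) (d : seq nat) (fuel m : nat) : seq nat :=
  if fuel is fuel'.+1 then
    m :: (if m == n then [::] else bounce_from n d fuel' (d_at n d m.+1))
  else [::].

Definition bounce (n : nat) (d : seq nat) : seq nat :=
  bounce_from n d n (d_at n d 1).

(* The element of [n] = {1, ..., n} represented by v : 'I_n. *)
Definition label (n : nat) (v : 'I_n) : nat := v.+1.

(* S_i = {m_{i-2} + 1, ..., m_{i-1}} for i >= 1, where m_{-1} = 0. *)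
Definition bounce_block (n : nat) (d : seq nat) (i : nat) : {set 'I_n} :=
  let m := 0 :: bounce n d in
  [set v : 'I_n | nth 0 m i.-1 < label v <= nth 0 m i].

Definition poset_lt (n : nat) (d : seq nat) : rel 'I_n :=
  fun i j => [&& label i < n, d_at n d (label i) < label j & label j <= n].

Definition inc_graph (n : nat) (lt : rel 'I_n) : rel 'I_n :=
  fun i j => [&& i != j, ~~ lt i j & ~~ lt j i].

Definition proper_coloring (n N : nat) (G : rel 'I_n)
    (kappa : {ffun 'I_n -> 'I_N}) : bool :=
  [forall i, forall j, G i j ==> (kappa i != kappa j)].

Definition asc (n N : nat) (G : rel 'I_n) (kappa : {ffun 'I_n -> 'I_N}) : nat :=
  #|[set p : 'I_n * 'I_n |
      [&& G p.1 p.2, p.1 < p.2 & kappa p.1 < kappa p.2]]|.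

Local Open Scope ring_scope.

(* X_G(x_1, ..., x_N, q), the image of X_G(x, q) under x_i = 0 for i > N;
   q is the variable of the coefficient ring {poly int}. *)
Definition chrom_qsym (n : nat) (G : rel 'I_n) (N : nat) :
    {mpoly {poly int}[N]} :=
  \sum_(kappa : {ffun 'I_n -> 'I_N} | proper_coloring G kappa)
    ('X^(asc G kappa) : {poly int}) *: \prod_(v : 'I_n) 'X_(kappa v).

Definition elem_sym (N : nat) (s : seq nat) : {mpoly {poly int}[N]} :=
  \prod_(k <- s) mesym N {poly int} k.

Definition is_partition (n : nat) (s : seq nat) : bool :=
  [&& sorted geq s, 0%N \notin s & sumn s == n].

(* Partitions are written without zero parts: (n, 0, 0) is (n). *)
Definition drop_zeros (s : seq nat) : seq nat := [seq k <- s | k != 0%N].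

(* X = \sum_(lambda |- n) c_lambda e_lambda in infinitely many variables.
   A symmetric function is represented by the family of its truncations X N to
   x_1, ..., x_N; a monomial involves finitely many variables, so an identity
   of formal power series is the same as the identity of all truncations.  The
   coefficients do not depend on N, which makes them unique.  A partition of n
   has at most n parts, all at most n, so the index type covers all of them. *)
Definition e_expansion (n : nat) (X : forall N : nat, {mpoly {poly int}[N]})
    (c : seq nat -> {poly int}) : Prop :=
  forall N : nat,
    X N = \sum_(s : n.-bseq 'I_n.+1 | is_partition n (map val s))
            c (map val s) *: elem_sym N (map val s).

(* Main.v *)
(** Chains of [P] have at most 3 elements, since each bounce block is an
    antichain. Hence [X_G] has no monomial with an exponent above 3, and only
    [e_s] with at most three parts occur. In three parts, the coefficient of
    [e_(n-2l, l, l)] in a symmetric function [f] is read off by extracting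
    [x_1^3 ... x_l^3] and then the coefficient of [e_k], [k = n - 3 l], from
    what is left; by Newton's identities the latter is the sum over the
    compositions [beta] of [k] of [(-1)^(k - size beta) beta_1 [x^beta]].

    Grouping colorings by the acyclic orientation they induce writes [X_G] as
    a sum of [q^asc] times generating functions of strict labelings of an
    acyclic orientation; a product of elementary symmetric functions is the
    generating function of strict labelings of a disjoint union of chains. On
    such a generating function the functional counts the ways to delete [l]
    times three sinks so that at most one sink remains, as one sees by deleting
    the vertices of the largest color and using
    [\sum_(S \subset Z) (-1)^|S| |S| = - (|Z| == 1)]. The count is a natural
    number, and for chains it singles out the partition [(n-2l, l, l)]. *)

Require Import Defs.
From mathcomp Require Import all_boot all_order all_algebra.
From mathcomp Require Import mpoly.
From mathcomp Require Import zify.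

Set Implicit Arguments.
Unset Strict Implicit.
Unset Printing Implicit Defensive.

Import Order.TTheory GRing.Theory Num.Theory.

Local Open Scope ring_scope.

(** * Signed binomial sums and compositions *)

(** Expand [(1 - 1)^z = 0] and isolate the term [j = 0]; terms with [j > z] vanish, which leaves the
    upper bound [m] free. *)
Lemma sum_signed_binomials (R : comPzRingType) (z m : nat) : (0 < z <= m)%N ->
  \sum_(j <- iota 1 m) (-1) ^+ j.+1 * 'C(z, j)%:R = 1 :> R.
Proof.
move=> /andP[z_gt0 le_zm].
have := exprBn (1 : R) 1 z; rewrite subrr expr0n eqn0Ngt z_gt0 /=.
pose F j : R := (-1) ^+ j * 1 ^+ (z - j) * 1 ^+ j *+ 'C(z, j).
rewrite -/(F _) (big_ord_widen_cond m.+1 xpredT F) ?ltnS // big_mkcond.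
rewrite -(big_mkord xpredT (fun j => if (j < z.+1)%N then F j else 0)) /F.
rewrite /index_iota subn0 /= big_cons /= bin0 !expr1n !mul1r => /eqP.
rewrite eq_sym addr_eq0 mulr1n => /eqP E.
rewrite [RHS]E -sumrN; apply: eq_bigr => j _.
rewrite exprS mulN1r mulNr !expr1n !mulr1 mulr_natr.
by case: ltnP => // lt_zj; rewrite bin_small.
Qed.

(** Absorption and Pascal's rule give [j C(z, j) = z (C(z, j) - C(z-1, j))]. For [z > 1] both
    resulting sums equal 1 and cancel. *)
Lemma sum_signed_weighted_binomials (R : comPzRingType) (z m : nat) :
  (0 < z <= m)%N ->
  \sum_(j <- iota 1 m) (-1) ^+ j.+1 * j%:R * 'C(z, j)%:R
    = (z == 1%N)%:R :> R.
Proof.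
case: z => // z /andP[_ le_zm].
have [->|z_gt0] := posnP z.
  case: m le_zm => // m _; rewrite /= big_cons bin1 big_seq big1 => [|j].
    by rewrite addr0 /= -signr_odd expr0 !mulr1.
  by rewrite mem_iota => /andP[lt_1j _]; rewrite bin_small // mulr0.
have E j : (0 < j)%N ->
    (-1) ^+ j.+1 * j%:R * 'C(z.+1, j)%:R =
    z.+1%:R * ((-1) ^+ j.+1 * 'C(z.+1, j)%:R
                 - (-1) ^+ j.+1 * 'C(z, j)%:R) :> R.
  case: j => // j _; rewrite -mulrA -natrM -[(j.+1 * _)%N]mul_bin_diag natrM.
  by rewrite -mulrBr binS natrD [_ + _ - _]addrC addrA addNr add0r mulrCA.
rewrite (eq_big_seq (fun j => z.+1%:R * ((-1) ^+ j.+1 * 'C(z.+1, j)%:R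
                 - (-1) ^+ j.+1 * 'C(z, j)%:R))); last first.
  by move=> j; rewrite mem_iota => /andP[j_gt0 _]; rewrite E.
rewrite -big_distrr /= sumrB !sum_signed_binomials ?subrr ?mulr0 ?le_zm //.
  by rewrite eqSS eqn0Ngt z_gt0.
by rewrite z_gt0 ltnW.
Qed.

(** The recursive call on [k - j] is not structural; [k] units of fuel suffice because every part is
    positive. *)
Fixpoint compositions_fuel (fuel k : nat) : seq (seq nat) :=
  if k == 0%N then [:: [::]] else
  if fuel is fuel'.+1 then
    [seq j :: beta | j <- iota 1 k, beta <- compositions_fuel fuel' (k - j)]
  else [::].

Definition compositions (k : nat) : seq (seq nat) := compositions_fuel k k.

Lemma compositions_fuelS (f k : nat) : compositions_fuel f.+1 k.+1 =
  [seq j :: beta | j <- iota 1 k.+1, beta <- compositions_fuel f (k.+1 - j)].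
Proof. by []. Qed.

Lemma compositions_fuelE (f k : nat) : (k <= f)%N ->
  compositions_fuel f k = compositions k.
Proof.
rewrite /compositions.
elim/ltn_ind: k f => -[|k] IH [|f] // le_kf; rewrite !compositions_fuelS.
congr flatten; apply/eq_in_map => j; rewrite mem_iota => /andP[j_gt0 le_jk].
by rewrite IH ?[in RHS]IH //; lia.
Qed.

Lemma compositionsS (k : nat) : compositions k.+1 =
  [seq j :: beta | j <- iota 1 k.+1, beta <- compositions (k.+1 - j)].
Proof.
rewrite {1}/compositions compositions_fuelS.
congr flatten; apply/eq_in_map => j; rewrite mem_iota => /andP[j_gt0 le_jk].
by rewrite compositions_fuelE //; lia.
Qed.

(** * The functional *)

Section Functionals.

Variable R : comPzRingType.
Implicit Type w : seq nat -> R.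

(** For [w beta] the coefficient of [x^beta] in a symmetric function of degree [k], this is the Hall
    pairing with [e_k], that is, the sum of all coefficients in the elementary basis. *)
Definition alternating_sum (k : nat) w : R :=
  \sum_(beta <- compositions k) (-1) ^+ (k + size beta) * w beta.

(* For [k = 0] the default of [head] makes this [w [::]]. *)
Definition marked_sum (k : nat) w : R :=
  \sum_(beta <- compositions k)
    (-1) ^+ (k + size beta) * (head 1%N beta)%:R * w beta.

Lemma alternating_sumS (k : nat) w : alternating_sum k.+1 w =
  \sum_(j <- iota 1 k.+1) (-1) ^+ j.+1 *
    alternating_sum (k.+1 - j) (fun beta => w (j :: beta)).
Proof.
rewrite /alternating_sum compositionsS big_allpairs_dep.
apply: eq_big_seq => j; rewrite mem_iota => /andP[j_gt0 le_jk].
rewrite big_distrr /=; apply: eq_bigr => beta _; rewrite mulrA -exprD.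
congr (_ * _); rewrite -signr_odd -[in RHS]signr_odd.
by congr (_ ^+ nat_of_bool _); lia.
Qed.

(** Only the first part is marked, so splitting it off leaves the unmarked functional. *)
Lemma marked_sumS (k : nat) w : marked_sum k.+1 w =
  \sum_(j <- iota 1 k.+1) (-1) ^+ j.+1 * j%:R *
    alternating_sum (k.+1 - j) (fun beta => w (j :: beta)).
Proof.
rewrite /marked_sum compositionsS big_allpairs_dep.
apply: eq_big_seq => j; rewrite mem_iota => /andP[j_gt0 le_jk].
rewrite big_distrr /=; apply: eq_bigr => beta _.
rewrite [_ * j%:R]mulrC [_ * j%:R]mulrC -!mulrA; congr (_ * _).
rewrite mulrA -exprD; congr (_ * _).
by rewrite -signr_odd -[in RHS]signr_odd; congr (_ ^+ nat_of_bool _); lia.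
Qed.

Lemma eq_alternating_sum (k : nat) w1 w2 :
  w1 =1 w2 -> alternating_sum k w1 = alternating_sum k w2.
Proof. by move=> eq_w; apply: eq_bigr => beta _; rewrite eq_w. Qed.

Lemma eq_marked_sum (k : nat) w1 w2 :
  w1 =1 w2 -> marked_sum k w1 = marked_sum k w2.
Proof. by move=> eq_w; apply: eq_bigr => beta _; rewrite eq_w. Qed.

Lemma alternating_sum_sum (I : finType) (P : pred I) (k : nat)
    (w : I -> seq nat -> R) :
  alternating_sum k (fun beta => \sum_(i | P i) w i beta) =
  \sum_(i | P i) alternating_sum k (w i).
Proof.
by rewrite exchange_big; apply: eq_bigr => beta _; rewrite big_distrr.
Qed.

Lemma marked_sum_linear (I : finType) (P : pred I) (k : nat)
    (a : I -> R) (w : I -> seq nat -> R) :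
  marked_sum k (fun beta => \sum_(i | P i) a i * w i beta) =
  \sum_(i | P i) a i * marked_sum k (w i).
Proof.
under [RHS]eq_bigr do rewrite big_distrr.
rewrite exchange_big; apply: eq_bigr => beta _; rewrite big_distrr.
by apply: eq_bigr => i _; rewrite /= mulrCA.
Qed.

End Functionals.

(* Common abstraction of an oriented graph losing some of its sinks and of a
   tuple of chains losing the tops of some of its nonempty members. *)
Section Peeling.

Variables (St : Type) (T : finType).
Variables (src : St -> {set T}) (step : St -> {set T} -> St) (sz : St -> nat).

(** Counts strict labelings with prescribed color class sizes, the classes being removed from the
    largest color down. *)
Fixpoint peelings (s : St) (alpha : seq nat) : nat :=
  if alpha is a :: alpha' then
    \sum_(S : {set T} | (S \subset src s) && (#|S| == a))
      peelings (step s S) alpha'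
  else (sz s == 0%N).

Hypothesis sz_step : forall s (S : {set T}),
  S \subset src s -> sz (step s S) = (sz s - #|S|)%N.
Hypothesis src_sz : forall s, (#|src s| <= sz s)%N.
Variable inv : St -> Prop.
Hypothesis inv_step : forall s (S : {set T}),
  inv s -> S \subset src s -> inv (step s S).
Hypothesis src_gt0 : forall s, inv s -> (0 < sz s)%N -> (0 < #|src s|)%N.

Variable R : comPzRingType.
Local Notation wt s := (fun alpha => (peelings s alpha)%:R : R).

(** Induction on the size: each of the [C(z, j)] choices of [j] among the [z] sources contributes 1,
    and the signed sum of these binomials is 1. *)
Lemma alternating_sum_peelings (s : St) :
  inv s -> alternating_sum (sz s) (wt s) = 1.
Proof.
move: {2}(sz s) (erefl (sz s)) => k; elim/ltn_ind: k s => -[|k] IH s Ek inv_s.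
  by rewrite /alternating_sum Ek big_seq1 /= Ek eqxx mulr1.
rewrite Ek alternating_sumS.
rewrite -[RHS](@sum_signed_binomials R #|src s| k.+1); last first.
  by rewrite src_gt0 ?Ek //= -Ek src_sz.
apply: eq_big_seq => j; rewrite mem_iota => /andP[j_gt0 le_jk].
congr (_ * _); under eq_alternating_sum do rewrite /= natr_sum.
rewrite alternating_sum_sum -cards_draws -sum1_card natr_sum.
apply: eq_big => [S|S /andP[sS /eqP cS]]; first by rewrite inE.
rewrite -[in LHS]Ek -cS -sz_step // (IH (k.+1 - j)%N) //.
- lia.
- by rewrite sz_step // Ek cS.
- exact: inv_step.
Qed.

(** After the first removal the unmarked functional gives 1, so what remains is the binomial sum
    weighted by [j], which detects a single source. *)
Lemma marked_sum_peelings (s : St) :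
  inv s -> marked_sum (sz s) (wt s) = (#|src s| <= 1)%:R.
Proof.
move=> inv_s; case Ek: (sz s) => [|k].
  (* Only the empty composition occurs; the default of [head] gives it weight 1, in agreement with
     there being no source. *)
  rewrite /marked_sum big_seq1 /= Ek eqxx !mulr1.
  by have := src_sz s; rewrite Ek leqn0 => /eqP ->.
have src_s : (0 < #|src s|)%N by rewrite src_gt0 ?Ek.
rewrite marked_sumS (_ : (_ <= 1)%N = (#|src s| == 1%N)); last by lia.
rewrite -(@sum_signed_weighted_binomials R #|src s| k.+1); last first.
  by rewrite src_s -Ek src_sz.
apply: eq_big_seq => j; rewrite mem_iota => /andP[j_gt0 le_jk].
congr (_ * _); under eq_alternating_sum do rewrite /= natr_sum.
rewrite alternating_sum_sum -cards_draws -sum1_card natr_sum.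
apply: eq_big => [S|S /andP[sS /eqP cS]]; first by rewrite inE.
rewrite -Ek -cS -sz_step // alternating_sum_peelings //; exact: inv_step.
Qed.

Fixpoint single_source_peelings (l : nat) (s : St) : nat :=
  if l is l'.+1 then
    \sum_(S : {set T} | (S \subset src s) && (#|S| == 3%N))
      single_source_peelings l' (step s S)
  else (#|src s| <= 1)%N.

(** The functional is linear, so it passes through the sums over the first [l] removed triples and
    acts on what is left. *)
Lemma marked_sum_nseq_peelings (l k : nat) (s : St) :
  inv s -> sz s = (3 * l + k)%N ->
  marked_sum k (fun beta => wt s (nseq l 3 ++ beta)) =
  (single_source_peelings l s)%:R.
Proof.
elim: l s => [|l IH] s inv_s Es.
  rewrite muln0 add0n in Es; rewrite -Es; exact: marked_sum_peelings.
rewrite /= natr_sum.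
under eq_marked_sum => beta.
  rewrite /= natr_sum; under eq_bigr do rewrite -[_%:R]mul1r.
  over.
rewrite (marked_sum_linear _ _ (fun=> 1)
  (fun S beta => wt (step s S) (nseq l 3 ++ beta))).
apply: eq_bigr => S /andP[sS /eqP cS]; rewrite mul1r IH //; first exact: inv_step.
by rewrite sz_step // Es cS; lia.
Qed.

End Peeling.

Definition mnm_of_seq (N : nat) (gamma : seq nat) : 'X_{1..N} :=
  [multinom nth 0%N gamma i | i < N].

Lemma sum_mnm1 (V : finType) (N : nat) (kappa : V -> 'I_N) (i : 'I_N) :
  (\sum_v U_(kappa v))%MM i = #|[set v | kappa v == i]|.
Proof.
rewrite mnm_sumE -sum1_card [RHS]big_mkcond; apply: eq_bigr => v _.
by rewrite mnm1E inE; case: ifP.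
Qed.

(** * Coefficients of the two kinds of generating functions *)

Section StrictColorings.

Variables (V : finType) (o : {set V * V}).

(** Arcs point towards larger colors, so the vertices of the largest color in [W] are sinks of
    [W]. *)
Definition sinks (W : {set V}) : {set V} :=
  [set v in W | [forall w in W, (v, w) \notin o]].

Definition sink_peelings : {set V} -> seq nat -> nat :=
  peelings sinks (fun W S => W :\: S) (fun W => #|W|).

Lemma marked_sum_sink_peelings (R : comPzRingType) (l k : nat) :
  (forall W : {set V}, (0 < #|W|)%N -> (0 < #|sinks W|)%N) ->
  #|V| = (3 * l + k)%N ->
  marked_sum k (fun beta => (sink_peelings setT (nseq l 3 ++ beta))%:R : R) =
  (single_source_peelings sinks (fun W S => W :\: S) l setT)%:R.
Proof.
move=> sinks_gt0 cV.
have sinks_sub W : sinks W \subset W.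
  by apply/subsetP => v; rewrite inE => /andP[].
apply: (marked_sum_nseq_peelings _ _ (inv := fun=> True)) => //.
- move=> W S sS; rewrite cardsD (setIidPr _) //.
  exact: subset_trans (sinks_sub W).
- by move=> W; apply/subset_leq_card.
- by move=> W _; apply: sinks_gt0.
- by rewrite cardsT.
Qed.

Variable N : nat.

Definition strict_coloring (kappa : {ffun V -> 'I_N}) : bool :=
  [forall v, forall w, ((v, w) \in o) ==> (kappa v < kappa w)%N].

Definition has_content (gamma : seq nat) (kappa : {ffun V -> 'I_N}) : bool :=
  [forall i : 'I_N, #|[set v | kappa v == i]| == nth 0%N gamma i].

(* Colors [j, ..., N-1] have been peeled off: outside [W] the coloring is
   prescribed by [kappa0]. *)
Definition strict_extension (gamma : seq nat) (j : nat) (W : {set V})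
    (kappa0 : V -> nat) (kappa : {ffun V -> 'I_N}) : bool :=
  [&& [forall v,
         if v \in W then (kappa v < j)%N else kappa v == kappa0 v :> nat],
      [forall v in W, forall w in W, ((v, w) \in o) ==> (kappa v < kappa w)%N]
    & [forall i : 'I_N, (i < j)%N ==>
        (#|[set v in W | kappa v == i]| == nth 0%N gamma i)]].

(** Induction on the number of free colors. The class of the largest one is a set of sinks of the
    prescribed size; fixing it leaves the same problem on the other vertices. The largest color goes
    first, hence [rev]. *)
Lemma card_strict_extensions (gamma : seq nat) (j : nat) (W : {set V})
    (kappa0 : V -> nat) :
  (j <= N)%N -> size gamma = N -> (forall v, v \notin W -> (kappa0 v < N)%N) ->
  (\sum_(kappa | strict_extension gamma j W kappa0 kappa) 1)%N =
  sink_peelings W (rev (take j gamma)).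
Proof.
move=> le_jN sz_gamma; elim: j le_jN W kappa0 => [|j IH] lt_jN W kappa0 kappa0N.
  (* Without free colors, an extension exists only for empty [W], and it is then [kappa0] itself. *)
  rewrite take0 /sink_peelings /=; have [W0|/set0Pn[v vW]] := eqVneq W set0.
    have kN v : (kappa0 v < N)%N by apply: kappa0N; rewrite W0 inE.
    rewrite (big_pred1 [ffun v => Ordinal (kN v)]) ?W0 ?cards0 // => kappa.
    apply/and3P/eqP => [[/forallP H _ _]|->].
      apply/ffunP => v; apply: val_inj; rewrite ffunE /=.
      by have := H v; rewrite inE => /eqP.
    split; apply/forallP => v; first by rewrite inE ffunE /=.
      by rewrite inE.
    by rewrite ltn0.
  rewrite big_pred0 => [|kappa].
    by rewrite cards_eq0; case: eqP vW => // ->; rewrite inE.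
  by apply/negbTE/negP => /and3P[/forallP/(_ v)]; rewrite vW ltn0.
pose oj := Ordinal lt_jN.
rewrite (take_nth 0%N) ?sz_gamma // rev_rcons /sink_peelings /=.
pose top (kappa : {ffun V -> 'I_N}) := [set v in W | kappa v == oj].
rewrite (partition_big top
  (fun S => (S \subset sinks W) && (#|S| == nth 0%N gamma j))); last first.
  move=> kappa /and3P[/forallP H1 /'forall_implyP H2 /forallP/(_ oj)/implyP H3].
  rewrite H3 //= andbT; apply/subsetP => v; rewrite !inE => /andP[vW /eqP kv].
  rewrite vW; apply/'forall_implyP => w wW; apply/negP => vw.
  have /'forall_implyP/(_ _ wW) := H2 _ vW; rewrite vw kv /=.
  by have := H1 w; rewrite wW ltnS ltnNge => ->.
apply: eq_bigr => S /andP[/subsetP sS /eqP cS].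
have sSW v : v \in S -> v \in W by move/sS; rewrite inE => /andP[].
(* The prescribed part now includes color [j] on [S]. *)
pose kappa1 v := if v \in S then j else kappa0 v.
rewrite -/(sink_peelings (W :\: S) _) -(IH (ltnW lt_jN) _ kappa1) => [|v]; last first.
  rewrite inE negb_and negbK /kappa1; case: ifP => //= _; exact: kappa0N.
apply: eq_bigl => kappa.
have below (i : 'I_N) : (i < j)%N -> (forall v, v \in S -> kappa v = j :> nat) ->
    [set v in W :\: S | kappa v == i] = [set v in W | kappa v == i].
  move=> lt_ij HS; apply/setP => v; rewrite !inE; case vS: (v \in S) => //=.
  by rewrite -val_eqE /= HS // gtn_eqF // andbF.
apply/andP/and3P => -[].
  move=> /and3P[/forallP H1 /'forall_implyP H2 /forallP H3] /eqP topE.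
  have HS v : v \in S -> kappa v = j :> nat.
    by rewrite -topE inE => /andP[_ /eqP ->].
  split.
  - apply/forallP => v; rewrite !inE /kappa1; have := H1 v.
    case vS: (v \in S) => /=; first by rewrite HS.
    case: ifP => // vW; rewrite ltnS leq_eqVlt => /orP[/eqP kv|//].
    by move: vS; rewrite -topE inE vW -val_eqE /= kv eqxx.
  - apply/'forall_implyP => v; rewrite inE => /andP[_ vW].
    apply/'forall_implyP => w; rewrite inE => /andP[_ wW].
    by have /'forall_implyP/(_ _ wW) := H2 _ vW.
  - apply/forallP => i; apply/implyP => lt_ij; rewrite below //.
    by have /implyP := H3 i; apply; apply: ltnW.
move=> /forallP H1 /'forall_implyP H2 /forallP H3.
have HS v : v \in S -> kappa v = j :> nat.
  by move=> vS; have := H1 v; rewrite inE /kappa1 vS /= => /eqP.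
have HW v : v \in W -> v \notin S -> (kappa v < j)%N.
  by move=> vW vS; have := H1 v; rewrite inE vW vS.
have topE : top kappa = S.
  apply/setP => v; rewrite inE -val_eqE /=; apply/andP/idP => [[vW /eqP kv]|vS].
    by apply: contraT => /(HW _ vW); rewrite kv ltnn.
  by rewrite sSW // HS.
split; last by rewrite topE.
apply/and3P; split.
- apply/forallP => v; have := H1 v; rewrite inE /kappa1.
  case vS: (v \in S) => /=; first by rewrite sSW // => /eqP ->.
  by case: ifP => // _; apply: ltnW.
- apply/'forall_implyP => v vW; apply/'forall_implyP => w wW; apply/implyP => vw.
  (* A sink in [S] has no arc into [W]; an arc into [S] ends at the top color; all other arcs stay
     in [W :\: S]. *)
  have [vS|vS] := boolP (v \in S).
    by have := sS _ vS; rewrite inE => /andP[_ /'forall_implyP/(_ _ wW)]; rewrite vw.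
  have [wS|wS] := boolP (w \in S); first by rewrite (HS w) // HW.
  have vWS : v \in W :\: S by rewrite inE vS.
  have wWS : w \in W :\: S by rewrite inE wS.
  by have /'forall_implyP/(_ _ wWS) := H2 _ vWS; rewrite vw.
- apply/forallP => i; rewrite ltnS leq_eqVlt; apply/implyP => /orP[/eqP ij|lt_ij].
    rewrite -ij in cS; rewrite -cS -topE; apply/eqP; congr #|pred_of_set _|.
    by apply/setP => v; rewrite !inE -!val_eqE /= ij.
  by rewrite -below //; have /implyP := H3 i; apply.
Qed.

Lemma card_strict_colorings (gamma : seq nat) : size gamma = N ->
  #|[set kappa | strict_coloring kappa && has_content gamma kappa]| =
  sink_peelings setT (rev gamma).
Proof.
move=> sz_gamma; have := @card_strict_extensions gamma N setT (fun=> 0%N).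
rewrite take_oversize ?sz_gamma // => <- //; last by move=> v; rewrite inE.
rewrite -sum1_card; apply: eq_bigl => kappa; rewrite inE.
have -> : strict_extension gamma N setT (fun=> 0%N) kappa =
    strict_coloring kappa && has_content gamma kappa.
  rewrite /strict_extension (_ : [forall v, _] = true) /=; last first.
    by apply/forallP => v; rewrite inE ltn_ord.
  congr (_ && _).
    by apply: eq_forallb => v; rewrite inE; apply: eq_forallb => w; rewrite inE.
  apply: eq_forallb => i; rewrite ltn_ord /=; congr (#|pred_of_set _| == _).
  by apply/setP => v; rewrite !inE.
by [].
Qed.

End StrictColorings.

(** * Products of elementary symmetric functions as disjoint unions of chains *)

Section ElementaryProducts.

Variable r : nat.
Implicit Type t : {ffun 'I_r -> nat}.

Definition nonzeros t : {set 'I_r} := [set i | (0 < t i)%N].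

Definition decrement t (S : {set 'I_r}) : {ffun 'I_r -> nat} :=
  [ffun i => (t i - (i \in S))%N].

Definition total t : nat := \sum_i t i.

Definition column_peelings : {ffun 'I_r -> nat} -> seq nat -> nat :=
  peelings nonzeros decrement total.

(** The columns in [S] are nonempty, so no truncated subtraction loses a unit. *)
Lemma total_decrement t (S : {set 'I_r}) :
  S \subset nonzeros t -> total (decrement t S) = (total t - #|S|)%N.
Proof.
move=> /subsetP sS; rewrite /total -sum1_card [X in (_ - X)%N]big_mkcond.
apply/eqP; rewrite -(eqn_add2r (\sum_i if i \in S then 1 else 0)%N) subnK.
  apply/eqP; rewrite -big_split /=; apply: eq_bigr => i _; rewrite ffunE.
  by case: ifP => [/sS|_]; rewrite ?inE ?subn0 ?addn0 // => ti; rewrite subnK.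
by apply: leq_sum => i _; case: ifP => // /sS; rewrite inE.
Qed.

Lemma card_nonzeros t : (#|nonzeros t| <= total t)%N.
Proof.
rewrite -sum1_card big_mkcond; apply: leq_sum => i _.
by rewrite inE; case: ifP.
Qed.

Lemma nonzeros_gt0 t : (0 < total t)%N -> (0 < #|nonzeros t|)%N.
Proof.
rewrite !lt0n cards_eq0; apply: contraNneq => nz0.
rewrite /total big1 // => i _; apply/eqP; rewrite -leqn0 leqNgt.
by have := in_set0 i; rewrite -nz0 inE => ->.
Qed.

Lemma marked_sum_column_peelings (R : comPzRingType) (l k : nat) t :
  total t = (3 * l + k)%N ->
  marked_sum k (fun beta => (column_peelings t (nseq l 3 ++ beta))%:R : R) =
  (single_source_peelings nonzeros decrement l t)%:R.
Proof.
apply: (marked_sum_nseq_peelings _ _ (inv := fun=> True)) => //.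
- exact: total_decrement.
- exact: card_nonzeros.
- by move=> u _; apply: nonzeros_gt0.
Qed.

Variable N : nat.

(** Counterpart of [strict_extension]: membership of the indices from [j] on is prescribed by [f0],
    and [t] holds the numbers of smaller indices still to be chosen. *)
Definition column_extension (gamma : seq nat) (j : nat) t
    (f0 : 'I_r -> {set 'I_N}) (f : {ffun 'I_r -> {set 'I_N}}) : bool :=
  [&& [forall i, [forall x : 'I_N,
         (j <= x)%N ==> ((x \in f i) == (x \in f0 i))]],
      [forall i, #|[set x in f i | (x < j)%N]| == t i]
    & [forall x : 'I_N, (x < j)%N ==> (#|[set i | x \in f i]| == nth 0%N gamma x)]].

(** As for strict colorings: the factors that use the largest free index form a set of nonempty
    columns, each of which loses its top. *)
Lemma card_column_extensions (gamma : seq nat) (j : nat) t f0 :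
  (j <= N)%N -> size gamma = N ->
  (\sum_(f | column_extension gamma j t f0 f) 1)%N =
  column_peelings t (rev (take j gamma)).
Proof.
move=> le_jN sz_gamma; elim: j le_jN t f0 => [|j IH] lt_jN t f0.
  rewrite take0 /column_peelings /=; have [t0|t0] := eqVneq (total t) 0%N.
    have {}t0 i : t i = 0%N.
      by apply/eqP; rewrite -leqn0 -t0 /total (bigD1 i) //= leq_addr.
    rewrite (big_pred1 [ffun i => f0 i]) // => f.
    apply/and3P/eqP => [[/forallP H _ _]|->].
      apply/ffunP => i; apply/setP => x; rewrite ffunE.
      by have /forallP/(_ x)/eqP := H i.
    split; apply/forallP => i; last by rewrite ltn0.
    - by apply/forallP => x; rewrite ffunE eqxx implybT.
    - by rewrite t0 cards_eq0; apply/eqP/setP => x; rewrite !inE andbF.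
  rewrite big_pred0 // => f; apply: contraNF t0 => /and3P[_ /forallP H _].
  rewrite /total big1 // => i _; rewrite -(eqP (H i)); apply: eq_card0 => x.
  by rewrite !inE andbF.
pose oj := Ordinal lt_jN.
rewrite (take_nth 0%N) ?sz_gamma // rev_rcons /column_peelings /=.
pose top (f : {ffun 'I_r -> {set 'I_N}}) := [set i | oj \in f i].
have split_le (f : {ffun 'I_r -> {set 'I_N}}) i :
    #|[set x in f i | (x < j.+1)%N]| =
    ((oj \in f i) + #|[set x in f i | (x < j)%N]|)%N.
  rewrite (cardsD1 oj) !inE /= leqnn andbT; congr (_ + #|pred_of_set _|)%N.
  apply/setP => x; rewrite !inE -val_eqE /= ltnS ltn_neqAle.
  by case: (x \in f i); rewrite ?andbF.
rewrite (partition_big top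
  (fun S => (S \subset nonzeros t) && (#|S| == nth 0%N gamma j))); last first.
  move=> f /and3P[_ /forallP H2 /forallP/(_ oj)/implyP H3].
  rewrite H3 //= andbT; apply/subsetP => i; rewrite !inE => ji.
  by rewrite -(eqP (H2 i)) split_le ji.
apply: eq_bigr => S /andP[/subsetP sS /eqP cS].
(* Outside [S] the index [oj] has to be removed, because [f0] is arbitrary there. *)
pose f1 i := if i \in S then oj |: f0 i else f0 i :\ oj.
rewrite -/(column_peelings (decrement t S) _) -(IH (ltnW lt_jN) _ f1); apply: eq_bigl => f.
apply/andP/and3P => -[].
  move=> /and3P[/forallP H1 /forallP H2 /forallP H3] /eqP topE; split.
  - apply/forallP => i; apply/forallP => x; rewrite leq_eqVlt.
    apply/implyP => /orP[/eqP jx|lt_jx].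
      have -> : x = oj by apply: val_inj.
      by rewrite /f1 -topE inE; case: (oj \in f i); rewrite !inE eqxx.
    have /forallP/(_ x) := H1 i; rewrite lt_jx => /eqP ->.
    by rewrite /f1; case: ifP; rewrite !inE -val_eqE /= gtn_eqF.
  - apply/forallP => i; have := H2 i; rewrite split_le ffunE -topE inE => /eqP <-.
    by rewrite addKn.
  - apply/forallP => x; apply/implyP => lt_xj.
    by have /implyP := H3 x; apply; apply: ltnW.
move=> /forallP H1 /forallP H2 /forallP H3.
have topE : top f = S.
  apply/setP => i; rewrite inE; have /forallP/(_ oj) := H1 i.
  by rewrite leqnn => /eqP ->; rewrite /f1; case: ifP; rewrite !inE eqxx.
split; last by rewrite topE.
apply/and3P; split.
- apply/forallP => i; apply/forallP => x; apply/implyP => lt_jx.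
  have /forallP/(_ x) := H1 i; rewrite ltnW // => /eqP ->.
  by rewrite /f1; case: ifP; rewrite !inE -val_eqE /= gtn_eqF.
- apply/forallP => i; rewrite split_le (eqP (H2 i)) ffunE -topE inE subnKC //.
  case ji: (oj \in f i) => //.
  by have := sS i; rewrite -topE !inE; apply.
- apply/forallP => x; rewrite ltnS leq_eqVlt; apply/implyP => /orP[/eqP xj|lt_xj].
    have -> : x = oj by apply: val_inj.
    by rewrite -[X in #|pred_of_set X|]/(top f) topE cS.
  by have /implyP := H3 x; apply.
Qed.

(** Expanding the product chooses a set of [t i] variables in each factor; the exponent of a
    variable is the number of chosen sets containing it. *)
Lemma mcoeff_prod_mesym (R : comNzRingType) t (gamma : seq nat) :
  size gamma = N ->
  (\prod_(i < r) mesym N R (t i))@_(mnm_of_seq N gamma) =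
  (column_peelings t (rev gamma))%:R.
Proof.
move=> sz_gamma; have := @card_column_extensions gamma N t (fun=> set0).
rewrite take_oversize ?sz_gamma // => <- //.
under [X in X@__]eq_bigr do rewrite mesymE.
rewrite bigA_distr_big_dep raddf_sum natr_sum /= [LHS]big_mkcond [RHS]big_mkcond.
apply: eq_bigr => f _; rewrite mprodXE mcoeffX.
have -> : (\sum_i mesym1 (f i))%MM == mnm_of_seq N gamma =
    [forall x : 'I_N, #|[set i | x \in f i]| == nth 0%N gamma x].
  apply/eqP/forallP => [E x|E].
    have /(congr1 (fun m : 'X_{1..N} => m x)) := E.
    rewrite /mnm_of_seq mnmE mnm_sumE => <-; rewrite -sum1_card [X in X == _]big_mkcond.
    by apply/eqP/eq_bigr => i _; rewrite inE mnmE; case: ifP.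
  apply/mnmP => x; rewrite mnmE mnm_sumE -(eqP (E x)) -sum1_card [RHS]big_mkcond.
  by apply: eq_bigr => i _; rewrite inE mnmE; case: (x \in f i).
have -> : column_extension gamma N t (fun=> set0) f =
    (f \in family (fun i => [pred h : {set 'I_N} | #|h| == t i])) &&
    [forall x : 'I_N, #|[set i | x \in f i]| == nth 0%N gamma x].
  rewrite /column_extension (_ : [forall i, _] = true) /=; last first.
    by apply/forallP => i; apply/forallP => x; rewrite leqNgt ltn_ord.
  congr (_ && _); last by apply: eq_forallb => x; rewrite ltn_ord.
  apply/forallP/familyP => H i; have := H i; rewrite inE /=;
    by congr (#|pred_of_set _| == _); apply/setP => x; rewrite !inE ltn_ord andbT.
by case: (f \in _) => //=; case: [forall x, _].
Qed.

End ElementaryProducts.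

(** * Acyclic orientations and the chromatic quasisymmetric function *)

Section Orientations.

Variables (n : nat) (G : rel 'I_n).

(** The exclusive or orients each edge in exactly one direction. Acyclicity is stated as the
    existence of sinks, the form that peeling requires. *)
Definition acyclic_orientation (o : {set 'I_n * 'I_n}) : bool :=
  [&& [forall v, forall w, ((v, w) \in o) ==> G v w],
      [forall v, forall w, G v w ==> ((v, w) \in o) (+) ((w, v) \in o)]
    & [forall W : {set 'I_n}, (0 < #|W|)%N ==> (0 < #|sinks o W|)%N]].

Definition ascents (o : {set 'I_n * 'I_n}) : nat :=
  #|[set p in o | (p.1 < p.2)%N]|.

Definition coloring_orientation (N : nat) (kappa : {ffun 'I_n -> 'I_N}) :=
  [set p : 'I_n * 'I_n | G p.1 p.2 && (kappa p.1 < kappa p.2)%N].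

Hypothesis G_sym : ssrbool.symmetric G.

Lemma coloring_orientation_acyclic (N : nat) (kappa : {ffun 'I_n -> 'I_N}) :
  proper_coloring G kappa -> acyclic_orientation (coloring_orientation kappa).
Proof.
move=> /forallP proper_kappa; apply/and3P; split.
- by apply/forallP => v; apply/forallP => w; apply/implyP; rewrite inE => /andP[].
- apply/forallP => v; apply/forallP => w; apply/implyP => Gvw; rewrite !inE /=.
  rewrite [G w v]G_sym Gvw /=; have /forallP/(_ w)/implyP/(_ Gvw) := proper_kappa v.
  by rewrite -val_eqE /=; case: ltngtP.
- apply/forallP => W; apply/implyP => /card_gt0P[v0 v0W].
  (* A vertex of largest color in [W] is a sink. *)
  have [v vW v_max] := arg_maxnP (fun v => val (kappa v)) v0W.
  apply/card_gt0P; exists v; rewrite inE; apply/andP; split; first exact: vW.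
  apply/'forall_implyP => w wW; rewrite !inE /= negb_and -leqNgt.
  by apply/orP; right; apply: v_max.
Qed.

(** Each edge carries one arc of [o], so a coloring increasing along [o] is proper and induces no
    other arc. *)
Lemma strict_coloringE (N : nat) (o : {set 'I_n * 'I_n})
    (kappa : {ffun 'I_n -> 'I_N}) : acyclic_orientation o ->
  proper_coloring G kappa && (coloring_orientation kappa == o) =
  strict_coloring o kappa.
Proof.
move=> /and3P[/forallP oG /forallP Go _].
have {}oG v w : (v, w) \in o -> G v w by have /forallP/(_ w)/implyP := oG v.
have {}Go v w : G v w -> ((v, w) \in o) (+) ((w, v) \in o).
  by have /forallP/(_ w)/implyP := Go v.
apply/andP/forallP => [[_ /eqP <-] v|strict_kappa].
  by apply/forallP => w; apply/implyP; rewrite inE => /andP[].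
have {}strict_kappa v w : (v, w) \in o -> (kappa v < kappa w)%N.
  by have /forallP/(_ w)/implyP := strict_kappa v.
split.
  apply/forallP => v; apply/forallP => w; apply/implyP => /Go.
  rewrite -val_eqE /=; case vw: (_ \in o) => /=; first by rewrite ltn_eqF ?strict_kappa.
  by move=> wv; rewrite gtn_eqF ?strict_kappa.
apply/eqP/setP => -[v w]; rewrite inE /=; apply/andP/idP => [[Gvw lt_vw]|vw].
  have := Go _ _ Gvw; case: (_ \in o) => //= /strict_kappa.
  by rewrite ltnNge ltnW.
by rewrite oG ?strict_kappa.
Qed.

(** Group the proper colorings by induced orientation: [asc] depends only on it, and each group
    consists of its strict colorings. *)
Lemma mcoeff_chrom_qsym (N : nat) (gamma : seq nat) : size gamma = N ->
  (chrom_qsym G N)@_(mnm_of_seq N gamma) =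
  \sum_(o | acyclic_orientation o)
    'X^(ascents o) * (sink_peelings o setT (rev gamma))%:R.
Proof.
move=> sz_gamma; rewrite raddf_sum /=.
rewrite (partition_big (@coloring_orientation N) acyclic_orientation) /=; last first.
  exact: coloring_orientation_acyclic.
apply: eq_bigr => o acyc_o.
rewrite -(@card_strict_colorings _ o N) // -sum1_card natr_sum big_distrr /=.
rewrite [RHS](eq_bigl (fun kappa =>
  strict_coloring o kappa && has_content gamma kappa)); last first.
  by move=> kappa; rewrite inE.
rewrite [RHS]big_mkcondr /=.
apply: eq_big => [kappa|kappa]; first exact: strict_coloringE.
move=> /andP[_ /eqP oE]; rewrite mcoeffZ mprodXE mcoeffX.
have -> : asc G kappa = ascents o.
  rewrite /asc /ascents -oE; congr #|pred_of_set _|; apply/setP => p.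
  by rewrite !inE; case: (G _ _); rewrite //= andbC.
have -> : (\sum_(v < n) U_(kappa v))%MM == mnm_of_seq N gamma =
    has_content gamma kappa.
  apply/eqP/forallP => [H i|H]; first by rewrite -sum_mnm1 H mnmE.
  by apply/mnmP => i; rewrite sum_mnm1 mnmE; apply/eqP.
by case: has_content; rewrite ?mulr1 ?mulr0.
Qed.

End Orientations.

(** * Vanishing of the coefficients of long partitions *)

Lemma sum_ord_ltn (n k : nat) : (k <= n)%N -> (\sum_(i < n) (i < k))%N = k.
Proof.
move=> le_kn; rewrite -[RHS]card_ord -sum1_card (big_ord_widen n (fun=> 1%N)) //.
by rewrite [RHS]big_mkcond; apply: eq_bigr => i _; case: ltnP.
Qed.

(** The leading monomial of [e_k] is the product of the first [k] variables, with coefficient 1, and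
    leading monomials multiply. *)
Lemma mlead_elem_sym (n : nat) (s : seq nat) : all (leq^~ n) s ->
  (mlead (elem_sym n s) = [multinom count (fun k => i < k)%N s | i < n]) *
  (mleadc (elem_sym n s) = 1).
Proof.
move=> /allP le_s.
have lreg_s k : k \in s -> true -> GRing.lreg (mleadc (mesym n {poly int} k)).
  by move=> /le_s le_kn _; rewrite mleadc_mesym //; apply: lreg1.
split; last first.
  rewrite /elem_sym mleadc_prod_proper // big_seq big1 // => k /le_s le_kn.
  exact: mleadc_mesym.
rewrite /elem_sym mlead_prod_proper //; apply/mnmP => i.
rewrite mnm_sumE mnmE -sum1_count [RHS]big_mkcond; apply: eq_big_seq => k /le_s le_kn.
by rewrite mlead_mesym // mnmE; case: ltnP.
Qed.

(** A partition is determined by its conjugate: multiplicities of parts are differences of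
    consecutive counts. *)
Lemma count_gt_inj (n : nat) (s t : seq nat) :
  is_partition n s -> is_partition n t -> all (leq^~ n) s -> all (leq^~ n) t ->
  (forall i, (i < n)%N -> count (fun k => i < k)%N s = count (fun k => i < k)%N t) ->
  s = t.
Proof.
move=> /and3P[s_sorted s0 _] /and3P[t_sorted t0 _] /allP sn /allP tn E.
have {}E i : count (fun k => i < k)%N s = count (fun k => i < k)%N t.
  have [/E //|le_ni] := ltnP i n.
  transitivity 0%N; last symmetry; apply/eqP; rewrite -leqn0 leqNgt -has_count;
    apply/hasPn => k /=; [move/sn | move/tn] => le_kn; rewrite -leqNgt;
    exact: leq_trans le_ni.
apply: (sorted_eq (leT := geq)) => //.
- by move=> y x z /= le_yx le_zy; apply: leq_trans le_yx.
- by move=> x y /= H; apply/anti_leq; rewrite andbC.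
apply/allP => -[|k] _ /=; first by rewrite !(count_memPn _).
have D (u : seq nat) : (count_mem k.+1 u + count (fun x => k.+1 < x)%N u)%N =
    count (fun x => k < x)%N u.
  by elim: u => //= x u <-; rewrite [(k < x)%N]leq_eqVlt eq_sym; case: ltngtP => /=; lia.
by rewrite -(eqn_add2r (count (fun x => k.+1 < x)%N s)) D E E D.
Qed.

Lemma mdeg_partition (n : nat) (s : seq nat) :
  sumn s = n -> all (leq^~ n) s ->
  mdeg [multinom count (fun k => i < k)%N s | i < n] = n.
Proof.
move=> sum_s /allP le_s; rewrite mdegE.
under eq_bigr do rewrite mnmE -sum1_count big_mkcond.
rewrite exchange_big /= -[RHS]sum_s sumnE; apply: eq_big_seq => k /le_s le_kn.
by rewrite -[RHS](sum_ord_ltn le_kn); apply: eq_bigr => i _; case: ltnP.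
Qed.

(* The leading monomial of [e_s] is the conjugate partition of [s], with first
   exponent [size s]; look at the largest one with [r < size s]. *)
Lemma e_expansion_long (n r : nat) (X : forall N, {mpoly {poly int}[N]})
    (c : seq nat -> {poly int}) :
  e_expansion n X c ->
  (forall N (m : 'X_{1..N}) i, (r < m i)%N -> (X N)@_m = 0) ->
  forall s : n.-bseq 'I_n.+1, is_partition n (map val s) -> (r < size s)%N ->
  c (map val s) = 0.
Proof.
move=> hc X0 s0 part_s0 size_s0; apply/eqP/negP => /negP c_s0.
pose P (s : n.-bseq 'I_n.+1) :=
  [&& is_partition n (map val s), (r < size s)%N & c (map val s) != 0].
have P0 : P s0 by rewrite /P part_s0 size_s0.
pose ld (s : n.-bseq 'I_n.+1) := mlead (elem_sym n (map val s)).
have le_all (s : n.-bseq 'I_n.+1) : all (leq^~ n) (map val s).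
  by rewrite all_map; elim: (bseqval s) => //= k u ->; rewrite -ltnS ltn_ord.
have n_gt0 : (0 < n)%N.
  by apply: leq_trans (size_bseq s0); apply: leq_ltn_trans size_s0.
pose i0 := Ordinal n_gt0.
have ldE s := (mlead_elem_sym (le_all s)).1.
have ld0 (s : n.-bseq 'I_n.+1) : is_partition n (map val s) -> ld s i0 = size s.
  move=> /and3P[_ s_neq0 _]; rewrite /ld ldE mnmE /=.
  rewrite -[RHS](size_map val); apply/eqP; rewrite -all_count; apply/allP => k ks.
  by rewrite lt0n; apply: contraNneq s_neq0 => <-.
have mdeg_ld (s : n.-bseq 'I_n.+1) : is_partition n (map val s) -> mdeg (ld s) = n.
  by move=> /and3P[_ _ /eqP sum_s]; rewrite /ld ldE mdeg_partition.
have [s Ps s_max] := Order.TotalTheory.arg_maxP ld P0.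
have /and3P[part_s size_s c_s] := Ps.
have := X0 n (ld s) i0; rewrite ld0 // => /(_ size_s); rewrite hc raddf_sum /=.
rewrite (bigD1 s) //= mcoeffZ (mlead_elem_sym (le_all s)).2 mulr1 big1 => [|t].
  by rewrite addr0 => /eqP; rewrite (negbTE c_s).
move=> /andP[part_t neq_ts]; rewrite mcoeffZ.
have [->|c_t] := eqVneq (c (map val t)) 0; first by rewrite mul0r.
rewrite mcoeff_gt_mlead ?mulr0 // -/(ld t).
(* Degrees agree, so a short [t] has a smaller leading monomial by its first exponent; a long one by
   the choice of [s] and injectivity of conjugation. *)
have [le_size|lt_size] := leqP (size t) r.
  apply/ltmcP; first by rewrite !mdeg_ld.
  by exists i0 => //; rewrite !ld0 //; apply: leq_ltn_trans size_s.
have le_ts : (ld t <= ld s)%O by apply: s_max; rewrite /P part_t lt_size.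
rewrite lt_neqAle le_ts andbT.
apply: contraNneq neq_ts => E; apply/eqP/val_inj/(inj_map val_inj).
apply: (count_gt_inj part_t part_s (le_all t) (le_all s)) => i lt_in.
by move/(congr1 (fun m : 'X_{1..n} => m (Ordinal lt_in))): E; rewrite /ld !ldE !mnmE.
Qed.

(** Exponents are sizes of color classes, and color classes are stable. *)
Lemma mcoeff_chrom_qsym_large (n r : nat) (G : rel 'I_n) :
  (forall A : {set 'I_n}, {in A &, forall v w, ~~ G v w} -> (#|A| <= r)%N) ->
  forall N (m : 'X_{1..N}) i, (r < m i)%N -> (chrom_qsym G N)@_m = 0.
Proof.
move=> stable_le N m i lt_rm.
rewrite raddf_sum big1 //= => kappa /forallP proper_kappa.
rewrite mcoeffZ mprodXE mcoeffX; case: eqP => [mE|_]; last by rewrite mulr0.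
suff: (m i <= r)%N by rewrite leqNgt lt_rm.
rewrite -mE sum_mnm1; apply: stable_le => v w; rewrite !inE => /eqP vi /eqP wi; apply/negP => Gvw.
by have /forallP/(_ w) := proper_kappa v; rewrite Gvw vi wi eqxx.
Qed.

(** * Products of at most three elementary symmetric functions *)

(** Padding with [e_0 = 1] gives all short partitions the same number of columns. *)
Lemma elem_sym_pad (r N : nat) (s : seq nat) : (size s <= r)%N ->
  elem_sym N s =
  \prod_(i < r) mesym N {poly int} ([ffun i : 'I_r => nth 0%N s i] i).
Proof.
move=> le_sr; under [RHS]eq_bigr do rewrite ffunE.
rewrite /elem_sym (big_nth 0%N) big_mkord.
rewrite (big_ord_widen r (fun i => mesym N {poly int} (nth 0%N s i))) // big_mkcond.
by apply: eq_bigr => i _; case: ltnP => // ?; rewrite nth_default // mesym0E.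
Qed.

(** Among three columns the only triple is the set of all of them, so each removal lowers every
    column by one. *)
Lemma single_source_peelings_columns (l : nat) (t : {ffun 'I_3 -> nat}) :
  single_source_peelings (@nonzeros 3) (@decrement 3) l t =
  ([forall i, l <= t i] && (#|[set i | l < t i]| <= 1))%N.
Proof.
elim: l t => [|l IH] t /=.
  by rewrite (_ : [forall i, _] = true) //; apply/forallP.
have full (S : {set 'I_3}) : (#|S| == 3)%N = (S == setT).
  have := max_card (mem S); rewrite eqEcard subsetT cardsT !card_ord /= eqn_leq.
  by move=> ->.
rewrite (eq_bigl (fun S => (S == setT) && (setT \subset nonzeros t))); last first.
  by move=> S; rewrite full andbC; case: eqP => // ->.
rewrite big_mkcondr big_pred1_eq.
case: ifPn => [/subsetP t_gt0|].
  have {}t_gt0 i : (0 < t i)%N by have := t_gt0 i; rewrite !inE; apply.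
  rewrite IH; congr (nat_of_bool (_ && (_ <= 1)%N)).
    by apply: eq_forallb => i; rewrite ffunE inE; have := t_gt0 i; lia.
  congr #|pred_of_set _|; apply/setP => i; rewrite !inE ffunE inE.
  by have := t_gt0 i; lia.
case/subsetPn => i _; rewrite inE => ti; rewrite (_ : [forall i, _] = false) //.
by apply/negbTE/forallPn; exists i; lia.
Qed.

(** * Bounce number three *)

Section BounceThree.

Variables (n : nat) (d : seq nat).
Hypothesis hd : dyck_path n d.

Lemma d_at_bounds (i : nat) : (0 < i <= n)%N -> (i <= d_at n d i <= n)%N.
Proof.
case: hd => size_d _ _ le_n ge_i /andP[i_gt0]; rewrite leq_eqVlt.
case/orP => [/eqP ->|lt_in]; last by rewrite ge_i ?le_n ?i_gt0.
(* The value at [n] lies just beyond the sequence and is the default [n]. *)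
by rewrite /d_at nth_default ?size_d // leqnn.
Qed.

Lemma d_at_homo (i j : nat) : (0 < i)%N -> (i <= j <= n)%N ->
  (d_at n d i <= d_at n d j)%N.
Proof.
move=> i_gt0 /andP[le_ij le_jn].
have [lt_jn|le_nj] := ltnP j n; last first.
  have -> : j = n by lia.
  have /andP[_ le_d] : (i <= d_at n d i <= n)%N by apply: d_at_bounds; lia.
  have /andP[le_n _] : (n <= d_at n d n <= n)%N by apply: d_at_bounds; lia.
  exact: leq_trans le_n.
case: hd => size_d _ sorted_d _ _.
apply: (sorted_leq_nth leq_trans leqnn n sorted_d); rewrite ?inE ?size_d; lia.
Qed.

(** A sequence of three terms has either reached [n] or used up exactly three units of fuel. *)
Lemma bounce_from_size3 (fuel m : nat) :
  size (bounce_from n d fuel m) = 3%N ->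
  let m1 := d_at n d m.+1 in let m2 := d_at n d m1.+1 in
  [/\ bounce_from n d fuel m = [:: m; m1; m2], m != n, m1 != n
    & (m2 == n) || (fuel == 3%N)].
Proof.
case: fuel => [|[|[|fuel]]] //=; case: (m == n) => //=; case: (_ == n) => //=.
case: (_ == n) => //=; by case: fuel => //= _; split.
Qed.

Hypothesis hm : size (bounce n d) = 3%N.

Lemma bounce3E : exists m0 m1 : nat,
  [/\ bounce n d = [:: m0; m1; n], d_at n d 1 = m0,
      d_at n d m0.+1 = m1 /\ d_at n d m1.+1 = n
    & (m0 < m1 < n)%N].
Proof.
have [] := bounce_from_size3 hm; rewrite -/(bounce n d).
set m0 := d_at n d 1; set m1 := d_at n d m0.+1; set m2 := d_at n d m1.+1.
move=> bE m0n m1n m2n; have n_gt0 : (0 < n)%N by move: hm; rewrite /bounce; case: (n).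
have b0 : (1 <= m0 <= n)%N by apply: d_at_bounds.
have b1 : (m0.+1 <= m1 <= n)%N by apply: d_at_bounds; lia.
have b2 : (m1.+1 <= m2 <= n)%N by apply: d_at_bounds; lia.
(* If the fuel ran out, then [n = 3], and three strictly increasing positive values bounded by 3 end
   at 3. *)
have m2E : m2 = n by lia.
by exists m0, m1; split=> //; [rewrite bE m2E | lia].
Qed.

Lemma inc_graph_sym : ssrbool.symmetric (inc_graph (@poset_lt n d)).
Proof. by move=> v w; rewrite /inc_graph eq_sym [X in _ && X]andbC. Qed.

(** Bounce blocks are antichains, so pairwise comparable elements lie in distinct blocks. *)
Lemma card_stable3 (A : {set 'I_n}) :
  {in A &, forall v w, ~~ inc_graph (@poset_lt n d) v w} -> (#|A| <= 3)%N.
Proof.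
have [m0 [m1 [_ d1 [dm0 dm1] lt_m]]] := bounce3E.
move=> stableA.
pose block (v : 'I_n) : 'I_3 := inord ((m0 < label v) + (m1 < label v)).
have not_lt v w : block v = block w -> ~~ poset_lt d v w.
  have lt3 (a b : bool) : (a + b < 3)%N by case: a; case: b.
  move=> /(congr1 val); rewrite /= !inordK ?lt3 //.
  move=> E; apply/negP => /and3P[lt_vn lt_dw le_wn].
  have v_gt0 : (0 < label v)%N by [].
  (* By monotonicity [d] at [v] is at least its value at the start of the block of [v], which is the
     end of that block; hence a larger [w] lies in a later block. *)
  have H1 : (d_at n d 1 <= d_at n d (label v))%N by apply: d_at_homo; lia.
  have H2 : (m0 < label v)%N -> (d_at n d m0.+1 <= d_at n d (label v))%N.
    by move=> ?; apply: d_at_homo; lia.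
  have H3 : (m1 < label v)%N -> (d_at n d m1.+1 <= d_at n d (label v))%N.
    by move=> ?; apply: d_at_homo; lia.
  lia.
have inj_block : {in A &, injective block}.
  move=> v w vA wA eq_vw; apply/eqP; have := stableA _ _ vA wA; apply: contraNT.
  by move=> neq_vw; rewrite /inc_graph neq_vw !not_lt.
rewrite -(card_in_imset inj_block).
by have := max_card (mem [set block v | v in A]); rewrite card_ord.
Qed.

Lemma card_bounce_blocks :
  (#|bounce_block n d 1| + #|bounce_block n d 2| + #|bounce_block n d 3| <= n)%N.
Proof.
have [m0 [m1 [bE _ _ lt_m]]] := bounce3E.
rewrite -[X in (_ <= X)%N]card_ord -!sum1_card.
rewrite ![\sum_(i in bounce_block _ _ _) _]big_mkcond -!big_split /=.
by apply: leq_sum => v _; rewrite !inE bE /=; do 3!case: ifP; lia.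
Qed.

End BounceThree.

(** * Reading off the coefficient *)

(** Parts decrease, so if only one may exceed [l] the last two equal [l]. For [l = 0] missing parts
    read as 0, which leaves [[:: n]]. *)
Lemma three_part_partition (n l : nat) (s : seq nat) :
  is_partition n s -> (size s <= 3)%N -> (0 < n)%N -> (3 * l <= n)%N ->
  ([forall i : 'I_3, l <= nth 0 s i] &&
    (#|[set i : 'I_3 | l < nth 0 s i]| <= 1))%N =
  (s == drop_zeros [:: (n - 2 * l)%N; l; l]).
Proof.
move=> part_s le_s3 n_gt0 le_3l_n.
have -> : [forall i : 'I_3, l <= nth 0 s i]%N =
    [&& l <= nth 0 s 0, l <= nth 0 s 1 & l <= nth 0 s 2]%N.
  apply/forallP/and3P => [le_l|[le0 le1 le2] [[|[|[|//]]] lt_i3]] //=.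
  by split; [have := le_l ord0 | have := le_l (Ordinal (isT : 1 < 3)%N)
            | have := le_l (Ordinal (isT : 2 < 3)%N)].
have -> : #|[set i : 'I_3 | (l < nth 0 s i)%N]| =
    ((l < nth 0 s 0) + (l < nth 0 s 1) + (l < nth 0 s 2))%N.
  rewrite -sum1_card big_mkcond !big_ord_recl big_ord0 !inE /=.
  by do 3!case: (l < _)%N.
have -> : drop_zeros [:: (n - 2 * l)%N; l; l] =
    if l == 0%N then [:: n] else [:: (n - 2 * l)%N; l; l].
  case: (l) le_3l_n => [_|l' le_l'n]; first by rewrite /= muln0 subn0 -lt0n n_gt0.
  by rewrite /drop_zeros /= ifT //; lia.
have nilE (x : nat) u : (([::] == x :: u) = false) * ((x :: u == [::]) = false).
  by [].
move: part_s; rewrite /is_partition.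
case: s le_s3 => [|x [|y [|z []]]] //= _; rewrite ?inE ?eqseq_cons ?negb_or;
  case: (posnP l) => [->|l_gt0]; rewrite ?(gtn_eqF l_gt0) ?eqseq_cons ?nilE ?eqxx /=; lia.
Qed.

Theorem theorem3p5 (n : nat) (d : seq nat)
    (hd : dyck_path n d) (hm : size (bounce n d) = 3)
    (c : seq nat -> {poly int})
    (hc : e_expansion n (chrom_qsym (inc_graph (@poset_lt n d))) c)
    (l : nat)
    (hl : (l <= minn #|bounce_block n d 3|
                 (minn #|bounce_block n d 2| #|bounce_block n d 1|))%N) :
  c (drop_zeros [:: (n - 2 * l)%N; l; l]) \is a polyOver Num.nat.
Proof.
have le_3l_n : (3 * l <= n)%N.
  by have := card_bounce_blocks hd hm; move: hl; rewrite !leq_min; lia.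
have n_gt2 : (2 < n)%N.
  have [m0 [m1 [_ m0E _ lt_m]]] := bounce3E hd hm.
  have : (1 <= d_at n d 1 <= n)%N by apply: d_at_bounds => //; lia.
  by rewrite m0E; lia.
pose G := inc_graph (@poset_lt n d).
have G_sym : ssrbool.symmetric G := @inc_graph_sym n d.
(* From here on only partitions with at most three parts contribute. *)
have c_long := e_expansion_long hc (mcoeff_chrom_qsym_large (card_stable3 hd hm)).
pose t (s : n.-bseq 'I_n.+1) : {ffun 'I_3 -> nat} :=
  [ffun i : 'I_3 => nth 0%N (map val s) i].
pose short (s : n.-bseq 'I_n.+1) :=
  is_partition n (map val s) && (size s <= 3)%N.
have sum_t s : short s -> total (t s) = n.
  case/andP => /and3P[_ _ /eqP sum_s] le_s3; rewrite -[RHS]sum_s sumnE /total.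
  rewrite (big_nth 0%N) size_map big_mkord.
  rewrite (big_ord_widen 3 (fun i => nth 0%N (map val s) i)) //.
  rewrite [RHS]big_mkcond; apply: eq_bigr => i _; rewrite ffunE.
  by case: ltnP => // ?; rewrite nth_default ?size_map.
have coefE (alpha : seq nat) :
    \sum_(s | short s) c (map val s) * (column_peelings (t s) alpha)%:R =
    \sum_(o | acyclic_orientation G o)
      'X^(ascents o) * (sink_peelings o setT alpha)%:R.
  (* The two expressions are one coefficient of the truncation to [size alpha] variables. *)
  rewrite -{2}[alpha]revK -(mcoeff_chrom_qsym G_sym (erefl (size (rev alpha)))).
  rewrite hc raddf_sum /= [RHS](bigID (fun s : n.-bseq 'I_n.+1 => (size s <= 3)%N)) /=.
  rewrite [X in _ = _ + X]big1 ?addr0 => [|s /andP[part_s]]; last first.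
    by rewrite -ltnNge mcoeffZ => /(c_long _ part_s) ->; rewrite mul0r.
  apply: eq_bigr => s /andP[_ le_s3]; rewrite mcoeffZ (@elem_sym_pad 3) ?size_map //.
  by rewrite mcoeff_prod_mesym // revK.
have sumE :
    \sum_(s | short s) c (map val s) *
      (single_source_peelings (@nonzeros 3) (@decrement 3) l (t s))%:R =
    \sum_(o | acyclic_orientation G o) 'X^(ascents o) *
      (single_source_peelings (sinks o) (fun W S => W :\: S) l setT)%:R.
  (* Apply the marked functional to both sides of [coefE], after [l] leading parts equal to 3. *)
  have nE : n = (3 * l + (n - 3 * l))%N by lia.
  pose w alpha : {poly int} := \sum_(s | short s)
     c (map val s) * (column_peelings (t s) (nseq l 3%N ++ alpha))%:R.
  transitivity (marked_sum (n - 3 * l) w).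
    rewrite /w marked_sum_linear; apply: eq_bigr => s /sum_t total_s.
    by rewrite marked_sum_column_peelings // total_s.
  rewrite (eq_marked_sum _ (fun alpha => coefE (nseq l 3%N ++ alpha))).
  rewrite marked_sum_linear; apply: eq_bigr => o /and3P[_ _ /forallP acyc_o].
  rewrite marked_sum_sink_peelings ?card_ord // => W; exact/implyP.
have sspE s : short s ->
    single_source_peelings (@nonzeros 3) (@decrement 3) l (t s) =
    (map val s == drop_zeros [:: (n - 2 * l)%N; l; l]).
  case/andP => part_s le_s3; rewrite -(three_part_partition part_s) ?size_map //.
    rewrite single_source_peelings_columns; under eq_forallb do rewrite ffunE.
    congr (nat_of_bool (_ && (#|pred_of_set _| <= 1)%N)).
    by apply/setP => i; rewrite !inE ffunE.
  by lia.
(* The target must be an element of the index type of the expansion: it has at most three parts,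
   [n > 2], and its parts are at most [n]. *)
pose target := drop_zeros [:: (n - 2 * l)%N; l; l].
have target_le : (size (map (@inord n) target) <= n)%N.
  by rewrite size_map size_filter; apply: leq_trans (count_size _ _) _.
pose tgt : n.-bseq 'I_n.+1 := Bseq target_le.
have tgtE : map val tgt = target.
  rewrite /tgt /= -map_comp map_id_in // => k.
  rewrite mem_filter !inE => /andP[_ /or3P[] /eqP ->]; rewrite /= inordK; lia.
have part_tgt : is_partition n target.
  rewrite /is_partition /target /drop_zeros mem_filter eqxx /=.
  by case: (posnP l) => [->|l_gt0] /=; do ?[case: ifP => /= ?]; lia.
have short_tgt : short tgt.
  rewrite /short tgtE part_tgt -(size_map val) tgtE size_filter.
  exact: count_size.
(* On the elementary side only the target survives, with factor 1. *)
move: sumE; rewrite (bigD1 tgt) //= big1 => [|s /andP[short_s neq_s]]; last first.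
  rewrite sspE // -/target -tgtE (inj_eq (inj_map val_inj)).
  by case: eqP => [E|_]; rewrite ?mulr0 //; case/eqP: neq_s; apply: val_inj.
rewrite addr0 sspE // tgtE eqxx mulr1 => ->.
(* The coefficient is now a sum of powers of [q] with natural multiplicities. *)
apply/polyOverP => i; rewrite coef_sum; apply: rpred_sum => o _.
by rewrite mulr_natr coefMn coefXn -mulrnA; apply: natr_nat.
Qed.
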